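(* Let $\mathbb{D}$ be a division ring with $|\mathbb{D}|>2$, let $n\ge2$, let $\preceq$ be a preorder on $[n]$ with associated structural matrix ring $\mathcal{R}_{\preceq}\subseteq M_n(\mathbb{D})$, and let $\phi:\mathcal{R}_{\preceq}\to M_n(\mathbb{D})$ be an injective Jordan semi-triple map. Suppose that every nonsymmetric comparable pair is nonisolated and that, whenever singleton connected components of the comparability graph $\Gamma_{\preceq}$ occur, $\mathbb{D}\cong\mathbb{F}_3$ or $\mathbb{D}\cong\mathbb{F}_4$. Then $\phi$ is additive.
   Context: For a preorder (reflexive and transitive relation) $\preceq$ on $[n]=\{1,\ldots,n\}$, the associated structural matrix ring (SMR) is $\mathcal{R}_{\preceq}:=\{[x_{ij}]\in M_n(\mathbb{D}) : x_{ij}=0 \text{ whenever } i\not\preceq j\}$. A map $\phi:\mathcal{R}\to\mathcal{S}$ between rings (no additivity assumed) is a Jordan semi-triple map if $\phi(xyx)=\phi(x)\phi(y)\phi(x)$ for all $x,y\in\mathcal{R}$. The comparability graph $\Gamma_{\preceq}$ has vertex set $[n]$, and two distinct vertices $i,j$ are joined by an edge precisely when $i\preceq j$ or $j\preceq i$. A pair $(i,j)$ is a nonsymmetric comparable pair if $i\preceq j$ and $j\not\preceq i$. Such a pair is nonisolated if there exists $k\in[n]\setminus\{i,j\}$ such that at least one of $k\preceq i\preceq j$, $i\preceq k\preceq j$, $i\preceq j\preceq k$ holds. $\mathbb{F}_q$ denotes the field with $q$ elements. *)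

(* Defs.v *)
From HB Require Import structures.
From mathcomp Require Import all_boot all_order all_algebra.

Set Implicit Arguments.
Unset Strict Implicit.
Unset Printing Implicit Defensive.

Import GRing.Theory.
Local Open Scope ring_scope.

(* MathComp has no structure of division rings: a unitRingType is a nonzero,
   possibly noncommutative ring, and GRing.unit its set of two-sided units. *)
Definition division_ring (D : unitRingType) : Prop :=
  forall x : D, x != 0 -> x \is a GRing.unit.

(* D may be infinite, so that #|D| is not available. *)
Definition has_more_than (k : nat) (T : eqType) : Prop :=
  exists s : seq T, uniq s /\ (k < size s)%N.

(* The notation 'F_q cannot be used here, since 'F_4 is the field with two
   elements; F is unique up to isomorphism. *)
Definition isomorphic_to_GF (q : nat) (R : nzRingType) : Prop :=
  exists (F : finFieldType) (f : {rmorphism R -> F}),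
    #|F| = q /\ bijective f.

(* The index set {1, ..., n} is represented by 'I_n = {0, ..., n - 1}. *)
Record preord (n : nat) := Preord {
  preord_rel :> rel 'I_n;
  preord_refl : reflexive preord_rel;
  preord_trans : transitive preord_rel
}.

Definition smr_mem (D : unitRingType) (n : nat) (P : preord n)
    : {pred 'M[D]_n} :=
  fun A => [forall i, forall j, ~~ P i j ==> (A i j == 0)].

Fact smr_subring_closed (D : unitRingType) (n : nat) (P : preord n) :
  subring_closed (smr_mem (D := D) P).
Proof.
have memP (A : 'M[D]_n) :
    reflect (forall i j, ~~ P i j -> A i j = 0) (A \in smr_mem P).
  apply: (iffP forallP) => [H i j nP | H i].
    by have /forallP/(_ j)/implyP/(_ nP)/eqP := H i.
  by apply/forallP => j; apply/implyP => nP; apply/eqP/H.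
split=> [|A B /memP HA /memP HB|A B /memP HA /memP HB]; apply/memP => i j nP.
- by rewrite mxE; case: eqP nP => // ->; rewrite preord_refl.
- by rewrite !mxE HA // HB // subr0.
rewrite mxE big1 // => k _.
have [Pik|nPik] := boolP (P i k); last by rewrite HA // mul0r.
rewrite HB ?mulr0 //; apply: contra nP; exact: preord_trans Pik.
Qed.

HB.instance Definition _ (D : unitRingType) (n : nat) (P : preord n) :=
  GRing.isSubringClosed.Build 'M[D]_n (smr_mem P) (smr_subring_closed D P).

Record smr (D : unitRingType) (n : nat) (P : preord n) := SMR {
  smr_val :> 'M[D]_n;
  smr_valP : smr_val \in smr_mem P
}.

HB.instance Definition _ (D : unitRingType) (n : nat) (P : preord n) :=
  [isSub for @smr_val D n P].
HB.instance Definition _ (D : unitRingType) (n : nat) (P : preord n) :=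
  [Choice of smr D P by <:].
HB.instance Definition _ (D : unitRingType) (n : nat) (P : preord n) :=
  GRing.SubChoice_isSubPzRing.Build 'M[D]_n (smr_mem P) (smr D P)
    (smr_subring_closed D P).

Definition jordan_semi_triple (R S : pzRingType) (phi : R -> S) : Prop :=
  forall x y : R, phi (x * y * x) = phi x * phi y * phi x.

Definition comparability (n : nat) (P : preord n) : rel 'I_n :=
  fun i j => (i != j) && (P i j || P j i).

Definition has_singleton_component (n : nat) (P : preord n) : Prop :=
  exists i : 'I_n, [set j | connect (comparability P) i j] = [set i].

Definition nonsymmetric_pair (n : nat) (P : preord n) (i j : 'I_n) : bool :=
  P i j && ~~ P j i.

Definition nonisolated (n : nat) (P : preord n) (i j : 'I_n) : Prop :=
  exists k : 'I_n, [/\ k != i, k != j &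
    [|| P k i && P i j, P i k && P k j | P i j && P j k]].

(* Main.v *)
Require Import Defs.
From HB Require Import structures.
From mathcomp Require Import all_boot all_order all_algebra all_field ring.

Set Implicit Arguments.
Unset Strict Implicit.
Unset Printing Implicit Defensive.

Import GRing.Theory.
Local Open Scope ring_scope.

(* The images of a maximal chain of diagonal idempotents give n orthogonal
   nonzero idempotents of M_n(D), hence a basis of D^n. This forces
   phi(0) = 0, phi(1)^2 = 1 and phi(E_ii) of rank one; after multiplying by
   phi(1) and using a scalar different from 0 and 1, the phi(E_ii) become
   orthogonal idempotents, and after conjugation phi(E_ii) = E_ii.

   The (i, j) entry of phi(x) then depends only on the 2 x 2 block of x with
   indices i, j. On the diagonal it is alpha_i(x_ii) with alpha_i an injective
   Jordan semi-triple map of D. A matrix unit E_ij is mapped to a multiple of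
   E_ij or of E_ji; passing to transposes over the converse ring, we may assume
   the former, say phi(E_ij) = c_ij E_ij, and then
   phi(t E_ij) = alpha_i(t) c_ij E_ij. For a symmetric pair i, j,
   the identity E_ij x E_ij = x_ji E_ij computes the off-diagonal entries of
   phi(x), and alpha_i is additive because (x y x)_ii = s + t for
   x = E_ii + E_ij + E_ji and y = s E_ii + t E_jj. For i <= j <= k,
   x = E_ii + s E_ij + t E_ik + E_jk has (x^2)_ik = s + t, which yields the
   additivity of alpha_i. *)

(** * Cancellation in a division ring and its converse *)

Section DivisionRing.

Variables (D : unitRingType) (divD : division_ring D).

Lemma div_lregP (a : D) : a != 0 -> injective ( *%R a).
Proof. by move/divD; apply: mulrI. Qed.

Lemma div_rregP (a : D) : a != 0 -> injective ( *%R^~ a).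
Proof. by move/divD; apply: mulIr. Qed.

Lemma div_mulf_eq0 (a b : D) : (a * b == 0) = (a == 0) || (b == 0).
Proof.
have [->|a0] := eqVneq a 0; first by rewrite mul0r eqxx.
by rewrite -{1}(mulr0 a) (inj_eq (div_lregP a0)).
Qed.

Lemma div_mulrV (a : D) : a != 0 -> a * a^-1 = 1.
Proof. by move/divD; apply: mulrV. Qed.

End DivisionRing.

Lemma division_ring_converse (D : unitRingType) :
  division_ring D -> division_ring D^c.
Proof.
move=> divD x /divD ux; apply/unitrP; exists (x : D)^-1.
by split; [apply: (mulrV ux)|apply: (mulVr ux)].
Qed.

(** * Triple products with matrix units and two-entry diagonal matrices *)

Section Sandwich.

Variables (R : nzRingType) (n : nat).
Implicit Types (A : 'M[R]_n) (i j k l a b : 'I_n).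

Lemma mulmx_delta_r A t k l a b :
  (A *m (t *: delta_mx k l)) a b = A a k * t * (b == l)%:R.
Proof.
rewrite mxE (bigD1 k) //= big1 => [|m mk].
  by rewrite !mxE eqxx /= addr0 mulrA.
by rewrite !mxE (negbTE mk) /= !mulr0.
Qed.

Lemma mulmx_sandwich A t k l a b :
  (A *m (t *: delta_mx k l) *m A) a b = A a k * t * A l b.
Proof.
rewrite mxE (bigD1 l) //= big1 => [|m ml].
  by rewrite mulmx_delta_r eqxx mulr1 addr0.
by rewrite mulmx_delta_r (negbTE ml) mulr0 mul0r.
Qed.

Lemma delta_sandwich A i j k l :
  delta_mx i j *m A *m delta_mx k l = A j k *: delta_mx i l.
Proof.
apply/matrixP => a b; rewrite -[delta_mx k l]scale1r mulmx_delta_r mulr1 !mxE.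
rewrite (bigD1 j) //= big1 => [|m mj]; last first.
  by rewrite !mxE (negbTE mj) andbF mul0r.
rewrite !mxE eqxx andbT addr0.
by case: (a == i); case: (b == l); rewrite ?(mul0r, mulr0, mul1r, mulr1).
Qed.

Lemma mulmx_sandwich1 A k l a b :
  (A *m delta_mx k l *m A) a b = A a k * A l b.
Proof. by rewrite -[delta_mx k l]scale1r mulmx_sandwich mulr1. Qed.

Lemma scale_delta_sandwich A s t i j k l :
  (s *: delta_mx i j) *m A *m (t *: delta_mx k l) =
  (s * A j k * t) *: delta_mx i l.
Proof.
apply/matrixP => a b; rewrite mulmx_delta_r -scalemxAl !mxE.
rewrite (bigD1 j) //= big1 => [|m mj]; last first.
  by rewrite !mxE (negbTE mj) andbF mul0r.
rewrite !mxE eqxx andbT addr0.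
by case: (a == i); case: (b == l); rewrite ?(mul0r, mulr0, mul1r, mulr1).
Qed.

(** For [i != j], multiplying by this matrix on both sides cuts out the 2 x 2 block with indices
    [i], [j] and rescales it. *)
Definition diag2 i j (u v : R) : 'M[R]_n :=
  u *: delta_mx i i + v *: delta_mx j j.

Lemma diag2E i j u v a b :
  diag2 i j u v a b =
  (u * (a == i)%:R + v * (a == j)%:R) * (a == b)%:R.
Proof.
rewrite !mxE; have [->|ab] := eqVneq a b; first by rewrite !andbb mulr1.
rewrite mulr0; have [ai|] := eqVneq a i; have [aj|] := eqVneq a j => /=.
- by rewrite -{1}ai -{1}aj ![b == a]eq_sym (negbTE ab) !mulr0 addr0.
- by rewrite -{1}ai ![b == a]eq_sym (negbTE ab) !mulr0 addr0.
- by rewrite -{1}aj ![b == a]eq_sym (negbTE ab) !mulr0 addr0.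
- by rewrite !mulr0 addr0.
Qed.

Lemma diag2_sandwich i j u v A a b :
  (diag2 i j u v *m A *m diag2 i j u v) a b =
  (u * (a == i)%:R + v * (a == j)%:R) * A a b *
  (u * (b == i)%:R + v * (b == j)%:R).
Proof.
rewrite mxE (bigD1 b) //= [X in _ + X]big1 => [|m mb]; last first.
  by rewrite diag2E (negbTE mb) !mulr0.
rewrite diag2E eqxx mulr1 addr0; congr (_ * _).
rewrite mxE (bigD1 a) //= big1 => [|m ma]; last first.
  by rewrite diag2E [a == m]eq_sym (negbTE ma) mulr0 mul0r.
by rewrite diag2E eqxx mulr1 addr0.
Qed.

Lemma sandwich_diag2 i j u v A a b :
  (A *m diag2 i j u v *m A) a b = A a i * u * A i b + A a j * v * A j b.
Proof. by rewrite mulmxDr mulmxDl mxE !mulmx_sandwich. Qed.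

End Sandwich.

(** * Linear algebra over a division ring *)

Section LinearAlgebra.

Variables (D : unitRingType) (divD : division_ring D).

(** Induction on the number of rows: a nonzero first row has its kernel parametrized by one
    coordinate fewer, and the remaining rows, restricted to that kernel, fall under the induction
    hypothesis. *)
Lemma wide_kernel m n (A : 'M[D]_(m, n)) : (m < n)%N ->
  exists2 x : 'cV[D]_n, x != 0 & A *m x = 0.
Proof.
elim: m n A => [|m IHm] [|n] // A lt_mn.
  exists (const_mx 1); last by rewrite [A]flatmx0 mul0mx.
  by apply/eqP => /matrixP/(_ 0 0)/eqP; rewrite !mxE oner_eq0.
have eqA (x : 'cV_n.+1) :
    (row 0 A *m x) 0 0 = 0 -> row' 0 A *m x = 0 -> A *m x = 0.
  move=> A0x A'x; apply/row_matrixP => i; rewrite row0 row_mul.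
  case: (unliftP 0 i) => [k ->|->].
    have -> : row (lift 0 k) A = row k (row' 0 A).
      by apply/rowP => l; rewrite !mxE.
    by rewrite -row_mul A'x row0.
  by apply/matrixP => i' j; rewrite !ord1 A0x mxE.
have [A0|] := eqVneq (row 0 A) 0.
  have [|x x0 A'x] := IHm n.+1 (row' 0 A); first exact: ltnW.
  by exists x => //; apply: eqA; rewrite // A0 mul0mx mxE.
case/matrix0Pn => i0 [j]; rewrite (ord1 i0) mxE => A0j.
(* The columns of [G] span the kernel of the first row of [A]. *)
pose G : 'M[D]_(n.+1, n) := \matrix_(k, l)
  if k == j then - (A 0 j)^-1 * A 0 (lift j l) else (k == lift j l)%:R.
have AG : row 0 A *m G = 0.
  apply/matrixP => i l; rewrite !mxE (bigD1 j) //= !mxE eqxx mulNr mulrN.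
  rewrite mulrA mulrV ?divD // mul1r.
  rewrite (bigD1 (lift j l)) /=; last by rewrite eq_sym neq_lift.
  rewrite !mxE eqxx eq_sym (negbTE (neq_lift _ _)) mulr1 big1 ?addr0 ?addNr //.
  by move=> k /andP[kj kl]; rewrite !mxE (negbTE kj) (negbTE kl) mulr0.
have [|x x0 A'x] := IHm n (row' 0 A *m G); first by [].
exists (G *m x); last first.
  by apply: eqA; rewrite mulmxA // AG mul0mx mxE.
have [l [k xl]] := matrix0Pn _ x0.
apply/eqP => /matrixP/(_ (lift j l) k); rewrite !mxE (bigD1 l) //= big1 => [|m' m'l].
  rewrite !mxE eq_sym (negbTE (neq_lift _ _)) eqxx mul1r addr0 => /eqP.
  by rewrite (negbTE xl).
rewrite !mxE eq_sym (negbTE (neq_lift _ _)) (inj_eq lift_inj) eq_sym.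
by rewrite (negbTE m'l) mul0r.
Qed.

(** A kernel vector [(y, z)] of the wide matrix [[T | u]] has [z] nonzero by injectivity, so
    [- y z^-1] is a preimage of [u]. Preimages of the basis vectors form a right inverse [T']; it is
    a left inverse since [T (T' T - 1) = 0]. *)
Lemma inj_mulmx_inv n (T : 'M[D]_n) :
    (forall x : 'cV_n, T *m x = 0 -> x = 0) ->
  exists T', T *m T' = 1%:M /\ T' *m T = 1%:M.
Proof.
move=> Tinj; have Tsurj (u : 'cV_n) : exists w, T *m w = u.
  have [|x x0] := @wide_kernel n (n + 1) (row_mx T u); first by rewrite addn1.
  rewrite -[x]vsubmxK mul_row_col; set y := usubmx x; set z := dsubmx x => eq0.
  have z0 : z 0 0 != 0.
    apply: contraNneq x0 => z0; have {}z0 : z = 0.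
      by apply/matrixP => i j; rewrite !ord1 z0 mxE.
    move: eq0; rewrite z0 mulmx0 addr0 => /Tinj y0.
    by rewrite -[x]vsubmxK -/y -/z z0 y0 col_mx0.
  clearbody y z; have zV : z *m const_mx (z 0 0)^-1 = 1%:M.
    apply/matrixP => i j; rewrite !ord1 !mxE big_ord1 !mxE.
    by rewrite mulrV ?divD.
  exists (- (y *m const_mx (z 0 0)^-1)); rewrite mulmxN mulmxA.
  have -> : T *m y = - (u *m z) by apply/eqP; rewrite -addr_eq0 eq0.
  by rewrite mulNmx opprK -mulmxA zV mulmx1.
have /fin_all_exists [w Tw] (i : 'I_n) := Tsurj (delta_mx i 0).
pose T' : 'M[D]_n := \matrix_(i, j) w j i 0.
have TT' : T *m T' = 1%:M.
  apply/matrixP => i j; move/matrixP/(_ i 0): (Tw j); rewrite !mxE eqxx andbT => <-.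
  by apply: eq_bigr => k _; rewrite mxE.
exists T'; split=> //; apply/eqP; rewrite -subr_eq0; apply/eqP.
apply/matrixP => i j; rewrite [RHS]mxE.
suff /matrixP/(_ i 0) : col j (T' *m T - 1%:M) = 0 by rewrite !mxE.
apply: Tinj; rewrite colE mulmxA mulmxBr mulmxA TT' mul1mx mulmx1 subrr.
by rewrite mul0mx.
Qed.

(** One nonzero column is chosen from each [f a]. As [f l] fixes the [l]-th column and kills the
    others, these columns are independent; they form the base change [T]. *)
Lemma orthogonal_idempotents n (f : 'I_n -> 'M[D]_n) :
    (forall i, f i != 0) -> (forall i, f i *m f i = f i) ->
    (forall i j, i != j -> f i *m f j = 0) ->
  exists T T', [/\ T *m T' = 1%:M, T' *m T = 1%:M &
    forall i, f i = T *m delta_mx i i *m T'].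
Proof.
move=> f0 ff fij.
have /fin_all_exists [b fb] (i : 'I_n) : exists b, col b (f i) != 0.
  have /matrix0Pn [k [b fkb]] := f0 i; exists b.
  by apply: contraNneq fkb => /matrixP/(_ k 0); rewrite !mxE => ->.
pose T : 'M[D]_n := \matrix_(x, a) f a x (b a).
have colT a : col a T = col (b a) (f a) by apply/matrixP => x y; rewrite !mxE.
have fT l : f l *m T = T *m delta_mx l l.
  apply/matrixP => x a; rewrite -[in RHS](scale1r (delta_mx l l)).
  have -> : (f l *m T) x a = (f l *m f a) x (b a).
    by rewrite !mxE; apply: eq_bigr => k _; rewrite !mxE.
  have -> : (T *m (1 *: delta_mx l l)) x a = T x l * (a == l)%:R.
    rewrite mxE (bigD1 l) //= big1 => [|m ml].
      by rewrite !mxE eqxx /= addr0 mul1r.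
    by rewrite !mxE (negbTE ml) /= !mulr0.
  have [->|al] := eqVneq a l; first by rewrite ff !mxE mulr1.
  by rewrite fij 1?eq_sym // !mxE mulr0.
have [|T' [TT' T'T]] := @inj_mulmx_inv n T.
  move=> x Tx; apply/matrixP => l j; rewrite ord1 [RHS]mxE.
  have := congr1 (mulmx (f l)) Tx; rewrite mulmxA fT mulmx0 -mulmxA.
  have /matrix0Pn [k [c fk]] := fb l.
  move/matrixP/(_ k 0); rewrite mxE (bigD1 l) //= big1 => [|m ml]; last first.
    rewrite [X in _ * X]mxE big1 ?mulr0 // => i _; rewrite !mxE.
    by rewrite (negbTE ml) mul0r.
  rewrite addr0 [X in _ * X]mxE (bigD1 l) //= big1 => [|m ml]; last first.
    by rewrite mxE (negbTE ml) andbF mul0r.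
  rewrite !mxE !eqxx mul1r addr0; move: fk; rewrite mxE => /divD fk fx0.
  by apply: (mulrI fk); rewrite fx0 mulr0.
exists T, T'; split=> // i; by rewrite -fT -mulmxA TT' mulmx1.
Qed.

End LinearAlgebra.

(** * Membership in the structural matrix ring *)

Section StructuralMatrices.

Variables (D : unitRingType) (n : nat) (P : preord n).
Implicit Types (A B : 'M[D]_n).

Lemma smr_memP A :
  reflect (forall i j, ~~ P i j -> A i j = 0) (A \in smr_mem P).
Proof.
apply: (iffP forallP) => [H i j nP | H i].
  by have /forallP/(_ j)/implyP/(_ nP)/eqP := H i.
by apply/forallP => j; apply/implyP => nP; apply/eqP/H.
Qed.

Lemma smr_memM A B :
  A \in smr_mem P -> B \in smr_mem P -> A *m B \in smr_mem P.
Proof. exact: rpredM. Qed.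

Lemma smr_memD A B :
  A \in smr_mem P -> B \in smr_mem P -> A + B \in smr_mem P.
Proof. exact: rpredD. Qed.

Lemma smr_mem_delta (t : D) i j : P i j -> t *: delta_mx i j \in smr_mem P.
Proof.
move=> Pij; apply/smr_memP => a b; rewrite !mxE.
case: eqP => [->|_]; case: eqP => [->|_] /=; rewrite ?mulr0 //.
by rewrite Pij.
Qed.

Lemma smr_mem_delta1 i j : P i j -> delta_mx i j \in smr_mem (D := D) P.
Proof. by rewrite -[delta_mx i j]scale1r; apply: smr_mem_delta. Qed.

Lemma smr_mem_diag2 i j (u v : D) : diag2 i j u v \in smr_mem P.
Proof. by apply: smr_memD; apply: smr_mem_delta; apply: preord_refl. Qed.

End StructuralMatrices.

Ltac smr_mem_tac := try assumption; lazymatch goal with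
  | |- is_true (_ *m _ \in _) => apply: smr_memM; smr_mem_tac
  | |- is_true (_ + _ \in _) => apply: smr_memD; smr_mem_tac
  | |- is_true (diag2 _ _ _ _ \in _) => apply: smr_mem_diag2
  | |- is_true (_ *: _ \in _) => apply: smr_mem_delta; smr_mem_tac
  | |- is_true (delta_mx _ _ \in _) => apply: smr_mem_delta1; smr_mem_tac
  | |- is_true (preord_rel _ ?i ?i) => apply: preord_refl
  | |- _ => auto
  end.

(** * Normalized maps and their dependence on 2 x 2 blocks *)

Section Normalized.

Variables (D D' : unitRingType) (divD' : division_ring D').
Variables (n : nat) (P : preord n) (psi : 'M[D]_n -> 'M[D']_n).

Local Notation R := (smr_mem (D := D) P).
Local Notation E i j := (delta_mx i j).

(** The target ring [D'] is separate from [D] so that the transposed map, with values over the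
    converse ring, is also covered. [psi] is total, but constrained only on [R]. *)
Definition normalized_jst : Prop :=
  [/\ forall x y, x \in R -> y \in R ->
        psi (x *m y *m x) = psi x *m psi y *m psi x,
      {in R &, injective psi}, psi 0 = 0, psi 1%:M = 1%:M &
      forall i, psi (E i i) = E i i].

Hypothesis npsi : normalized_jst.

Let psiJ x y : x \in R -> y \in R ->
  psi (x *m y *m x) = psi x *m psi y *m psi x.
Proof. by case: npsi => H *; apply: H. Qed.

Let psiI : {in R &, injective psi}. Proof. by case: npsi. Qed.
Let psi0 : psi 0 = 0. Proof. by case: npsi. Qed.
Let psi1 : psi 1%:M = 1%:M. Proof. by case: npsi. Qed.
Let psiE i : psi (E i i) = E i i. Proof. by case: npsi. Qed.

Lemma psi_sandwich x k a b : x \in R ->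
  psi (x *m E k k *m x) a b = psi x a k * psi x k b.
Proof.
move=> xR; rewrite psiJ //; last by smr_mem_tac.
by rewrite psiE mulmx_sandwich1.
Qed.

Definition alpha i t : D' := psi (t *: E i i) i i.

Lemma psi_diag x i : x \in R -> psi x i i = alpha i (x i i).
Proof.
move=> xR; rewrite /alpha -[_ *: _]delta_sandwich psiJ //; last by smr_mem_tac.
by rewrite psiE delta_sandwich !mxE eqxx mulr1.
Qed.

Lemma psi_scale_diag t i : psi (t *: E i i) = alpha i t *: E i i.
Proof.
have tE : t *: E i i = E i i *m (t *: E i i) *m E i i.
  by rewrite delta_sandwich !mxE eqxx mulr1.
by rewrite {1}tE psiJ ?psiE ?delta_sandwich //; smr_mem_tac.
Qed.

Lemma alpha0 i : alpha i 0 = 0.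
Proof. by rewrite /alpha scale0r psi0 mxE. Qed.

Lemma alpha1 i : alpha i 1 = 1.
Proof. by rewrite /alpha scale1r psiE !mxE eqxx. Qed.

Lemma alpha_inj i : injective (alpha i).
Proof.
move=> s t st; have : psi (s *: E i i) = psi (t *: E i i).
  by rewrite !psi_scale_diag st.
move/psiI => /(_ _ _)/matrixP/(_ i i); rewrite !mxE eqxx !mulr1; apply; smr_mem_tac.
Qed.

Lemma alpha_eq0 i t : (alpha i t == 0) = (t == 0).
Proof. by rewrite -(alpha0 i) (inj_eq (@alpha_inj i)). Qed.

Lemma alphaJ i s t : alpha i (s * t * s) = alpha i s * alpha i t * alpha i s.
Proof.
have -> : s * t * s = (s *: E i i *m (t *: E i i) *m (s *: E i i)) i i.
  by rewrite mulmx_sandwich !mxE eqxx !mulr1.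
rewrite -psi_diag; last by smr_mem_tac.
rewrite psiJ; [|by smr_mem_tac..].
by rewrite !psi_scale_diag mulmx_sandwich !mxE eqxx !mulr1.
Qed.

(** For [e = diag2 i j 1 1], [e 1 e = e] makes [psi e] its own square. The [k]-th term in each entry
    of this square comes from [psi (e E_kk e)], which is [E_kk] if [k] is [i] or [j], and 0
    otherwise. *)
Lemma psi_idem i j : i != j -> psi (diag2 i j 1 1) = diag2 i j 1 1.
Proof.
move=> ij; set e := diag2 i j 1 1.
have eR : e \in R by apply: smr_mem_diag2.
have ee : e *m 1%:M *m e = e.
  apply/matrixP => a b; rewrite diag2_sandwich diag2E !mxE !mul1r.
  have [->|ab] := eqVneq a b; last by rewrite !mulr0 mul0r.
  rewrite !mulr1; have [->|] := eqVneq b i; last first.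
    by case: (b == j); rewrite /= ?addr0 ?add0r ?mulr1 ?mulr0.
  by rewrite (negbTE ij) addr0 mulr1.
apply/matrixP => a b; rewrite -{1}ee psiJ ?rpred1 // psi1 mulmx1 mxE.
have ke k : psi e a k * psi e k b =
    (((k == i) || (k == j))%:R *: E k k) a b :> D'.
  rewrite -psi_sandwich // (_ : e *m _ *m e = ((k == i) || (k == j))%:R *: E k k).
    by case: (_ || _); rewrite ?scale1r ?scale0r ?psiE ?psi0.
  apply/matrixP => c d; rewrite diag2_sandwich !mxE !mul1r.
  case: (c =P k) => [->|] /=; last by rewrite !mulr0 mul0r.
  case: (d =P k) => [->|] /=; last by rewrite !mulr0 mul0r.
  case: (k =P i) => [->|] /=; first by rewrite (negbTE ij) addr0 !mulr1.
  by rewrite add0r !mulr1; case: (k == j); rewrite ?mulr1 ?mulr0.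
under eq_bigr do rewrite ke.
rewrite (bigD1 i) //= (bigD1 j) /=; last by rewrite eq_sym.
rewrite big1 => [|k /andP[/negbTE-> /negbTE->]]; last by rewrite /= !mxE mul0r.
by rewrite !eqxx orbT !scale1r addr0 !mxE !mul1r.
Qed.

(* As [psi] fixes the idempotent [E i i + E j j], it maps the corresponding
   2 x 2 blocks to 2 x 2 blocks. *)
Lemma psi_local x y i j : x \in R -> y \in R ->
  x i i = y i i -> x i j = y i j -> x j i = y j i -> x j j = y j j ->
  psi x i j = psi y i j.
Proof.
move=> xR yR ii ij ji jj; have [eij|nij] := eqVneq i j.
  by rewrite -eij !psi_diag // ii.
set e : 'M[D]_n := diag2 i j 1 1; have eR : e \in R by apply: smr_mem_diag2.
have eb z : z \in R -> psi z i j = psi (e *m z *m e) i j.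
  move=> zR; rewrite psiJ // psi_idem // diag2_sandwich !mul1r !eqxx.
  by rewrite (negbTE nij) eq_sym (negbTE nij) addr0 add0r mul1r mulr1.
rewrite eb // [RHS]eb //; congr (psi _ i j); apply/matrixP => a b.
rewrite !diag2_sandwich !mul1r.
case: (a =P i) => [->|_]; [|case: (a =P j) => [->|_]];
  (case: (b =P i) => [->|_]; [|case: (b =P j) => [->|_]]);
  by rewrite ?ii ?ij ?ji ?jj // !addr0 ?mul0r ?mulr0.
Qed.

(** If [x i i] or [x j j] is 0, then [x] agrees on the block with a multiple of one diagonal unit.
    Otherwise [x E_ii x] falls under that case, and the nonzero factor [psi x i i] cancels from its
    [(i, j)] entry. *)
Lemma psi_off_eq0 x i j : x \in R -> i != j -> x i j = 0 -> x j i = 0 ->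
  psi x i j = 0.
Proof.
move=> xR nij ij ji; have nji : j == i = false by rewrite eq_sym (negbTE nij).
have loc z : z \in R -> z i j = 0 -> z j i = 0 ->
    (z i i == 0) || (z j j == 0) -> psi z i j = 0.
  move=> zR zij zji /orP[]/eqP z0.
    rewrite (@psi_local z (z j j *: E j j)) ?psi_scale_diag; smr_mem_tac;
      by rewrite !mxE ?eqxx ?(negbTE nij) ?nji /= ?mulr0 ?mulr1.
  rewrite (@psi_local z (z i i *: E i i)) ?psi_scale_diag; smr_mem_tac;
    by rewrite !mxE ?eqxx ?(negbTE nij) ?nji /= ?mulr0 ?mulr1.
have [xi0|xi0] := eqVneq (x i i) 0; first by apply: loc; rewrite ?xi0 ?eqxx.
have := psi_sandwich i i j xR; rewrite loc; last first.
- by rewrite !mulmx_sandwich1 ij !mulr0 eqxx orbT.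
- by rewrite mulmx_sandwich1 ji !mul0r.
- by rewrite mulmx_sandwich1 ij !mulr0.
- by smr_mem_tac.
move/esym/eqP; rewrite div_mulf_eq0 // psi_diag // alpha_eq0 (negbTE xi0).
by move/eqP.
Qed.

Lemma psi_diag2 i j u v : i != j ->
  psi (diag2 i j u v) = diag2 i j (alpha i u) (alpha j v).
Proof.
move=> nij; have dR : diag2 i j u v \in R by smr_mem_tac.
apply/matrixP => a b; rewrite [RHS]diag2E.
have [<-|ab] := eqVneq a b; last first.
  by rewrite mulr0 psi_off_eq0 // diag2E ?[b == a]eq_sym (negbTE ab) mulr0.
rewrite psi_diag // diag2E eqxx !mulr1.
have [->|ai] := eqVneq a i; first by rewrite (negbTE nij) !mulr0 !addr0 !mulr1.
have [->|aj] := eqVneq a j; first by rewrite !mulr0 !add0r !mulr1.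
by rewrite !mulr0 !addr0 alpha0.
Qed.

Lemma psi_diag2_sandwich i j u v x a b : i != j -> x \in R ->
  psi (diag2 i j u v *m x *m diag2 i j u v) a b =
  (alpha i u * (a == i)%:R + alpha j v * (a == j)%:R) * psi x a b *
  (alpha i u * (b == i)%:R + alpha j v * (b == j)%:R).
Proof.
move=> nij xR; rewrite psiJ //; last by smr_mem_tac.
by rewrite psi_diag2 // diag2_sandwich.
Qed.

Lemma psi_sandwich_diag2 i j u v x a b : i != j -> x \in R ->
  psi (x *m diag2 i j u v *m x) a b =
  psi x a i * alpha i u * psi x i b + psi x a j * alpha j v * psi x j b.
Proof.
move=> nij xR; rewrite psiJ //; last by smr_mem_tac.
by rewrite psi_diag2 // sandwich_diag2.
Qed.

(* On a triangular 2 x 2 block with nonzero diagonal, [psi] maps the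
   off-diagonal entry [t] to [alpha i t * kappa i j]; when the diagonal is zero,
   [kappa i j] is replaced with [unit_coef i j], defined below. For an isolated
   nonsymmetric pair the two coefficients may differ. *)
Definition kappa i j := psi (diag2 i j 1 1 + E i j) i j.

(** If [y i i] is nonzero, then on the block [y E_ii y] is a diagonal rescaling of [u E_ii u], where
    [u] is unipotent with the same off-diagonal entry; cancellation gives [psi y i j = psi u i j]. A
    nonzero [y j j] is treated alike with [E_jj]. *)
Lemma psi_kappa x i j : P i j -> i != j -> x \in R -> x j i = 0 ->
  (x i i != 0) || (x j j != 0) -> psi x i j = alpha i (x i j) * kappa i j.
Proof.
move=> Pij nij xR ji; have nji : j == i = false by rewrite eq_sym (negbTE nij).
have bE := (eqxx, negbTE nij, nji, @mulmx_sandwich1, @diag2_sandwich,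
  mulr0, mul0r, mulr1, mul1r, addr0, add0r).
pose u t : 'M[D]_n := diag2 i j 1 1 + t *: E i j.
have uR t : u t \in R by rewrite /u; smr_mem_tac.
have uii t : u t i i = 1 by rewrite mxE diag2E !mxE !bE.
have ujj t : u t j j = 1 by rewrite mxE diag2E !mxE !bE.
have uij t : u t i j = t by rewrite mxE diag2E !mxE !bE.
have uji t : u t j i = 0 by rewrite mxE diag2E !mxE !bE.
have u_i y : y \in R -> y j i = 0 -> y i i != 0 ->
    psi y i j = psi (u (y i j)) i j.
  move=> yR yji y0; have := psi_sandwich i i j yR.
  rewrite psi_diag // (@psi_local _ (diag2 i j (y i i) 1 *m
    (u (y i j) *m E i i *m u (y i j)) *m diag2 i j (y i i) 1)); first last.
  - by rewrite !bE uji yji !bE.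
  - by rewrite !bE uji yji !bE.
  - by rewrite !bE uij uii !bE.
  - by rewrite !bE uii !bE.
  - by smr_mem_tac.
  - by smr_mem_tac.
  rewrite psi_diag2_sandwich //; last by smr_mem_tac.
  rewrite psi_sandwich // psi_diag // uii alpha1 !bE alpha1 mulr1.
  by move/(div_lregP divD'); rewrite alpha_eq0 => /(_ y0).
have u_j y : y \in R -> y j i = 0 -> y j j != 0 ->
    psi y i j = psi (u (y i j)) i j.
  move=> yR yji y0; have := psi_sandwich j i j yR.
  rewrite (psi_diag j) // (@psi_local _ (diag2 i j 1 (y j j) *m
    (u (y i j) *m E j j *m u (y i j)) *m diag2 i j 1 (y j j))); first last.
  - by rewrite !bE ujj !bE.
  - by rewrite !bE uji yji !bE.
  - by rewrite !bE uij ujj !bE.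
  - by rewrite !bE uji yji !bE.
  - by smr_mem_tac.
  - by smr_mem_tac.
  rewrite psi_diag2_sandwich //; last by smr_mem_tac.
  rewrite psi_sandwich // (psi_diag j) // ujj alpha1 !bE alpha1 mul1r.
  by move/(div_rregP divD'); rewrite alpha_eq0 => /(_ y0).
(* Rescaling [u 1] by [diag2 i j t 1] produces the off-diagonal entry [t] and keeps 1 at [(j, j)],
   so [u_j] applies even for [t = 0]. *)
have uk t : psi (u t) i j = alpha i t * kappa i j.
  rewrite /kappa -[E i j]scale1r -/(u 1).
  have := psi_diag2_sandwich t 1 i j nij (uR 1).
  rewrite u_j; first last.
  - by rewrite !bE ujj oner_neq0.
  - by rewrite !bE uji !bE.
  - by smr_mem_tac.
  by rewrite !bE uij !bE alpha1 mulr1.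
by case/orP=> x0; [rewrite u_i|rewrite u_j].
Qed.

(** * Images of off-diagonal matrix units *)

Lemma psi_unit_nilp i j t : P i j -> i != j ->
  psi (t *: E i j) i j * psi (t *: E i j) j i = 0.
Proof.
move=> Pij nij; rewrite -psi_sandwich; last by smr_mem_tac.
rewrite (_ : _ *m _ = 0) ?psi0 ?mxE //; apply/matrixP => a b.
by rewrite mulmx_sandwich1 !mxE [j == i]eq_sym (negbTE nij) !mulr0.
Qed.

Lemma psi_unit_entries i j t : P i j -> i != j ->
  psi (t *: E i j) =
  psi (t *: E i j) i j *: E i j + psi (t *: E i j) j i *: E j i.
Proof.
move=> Pij nij; have nji : j == i = false by rewrite eq_sym (negbTE nij).
have xR : t *: E i j \in R by smr_mem_tac.
apply/matrixP => a b; rewrite [in RHS]mxE [X in X + _]mxE [X in _ + X]mxE.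
rewrite [in X in X + _]mxE [in X in _ + X]mxE.
have [->|ab] := eqVneq a b.
  rewrite psi_diag // !mxE; have [->|bi] := eqVneq b i.
    by rewrite (negbTE nij) !mulr0 alpha0 addr0.
  by rewrite /= andbF !mulr0 alpha0 addr0.
have [abij|abij] := boolP ((a == i) && (b == j)).
  by case/andP: abij => /eqP-> /eqP->; rewrite !(negbTE nij) nji !mulr1 mulr0 addr0.
have [abji|abji] := boolP ((a == j) && (b == i)).
  by case/andP: abji => /eqP-> /eqP->; rewrite !mulr1 mulr0 add0r.
rewrite !mulr0 addr0 psi_off_eq0 // !mxE ?(negbTE abij) ?mulr0 //.
by rewrite andbC (negbTE abji) mulr0.
Qed.

Lemma psi_unit_scale i j u t v : P i j -> i != j ->
  psi ((u * t * v) *: E i j) i j = alpha i u * psi (t *: E i j) i j * alpha j v /\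
  psi ((u * t * v) *: E i j) j i = alpha j v * psi (t *: E i j) j i * alpha i u.
Proof.
move=> Pij nij; have nji : j == i = false by rewrite eq_sym (negbTE nij).
have -> : (u * t * v) *: E i j =
    diag2 i j u v *m (t *: E i j) *m diag2 i j u v.
  apply/matrixP => a b; rewrite diag2_sandwich !mxE.
  have [->|] := eqVneq a i; have [->|] := eqVneq b j => /=;
    rewrite ?nji ?(negbTE nij) /= ?mulr0 ?mul0r //.
  by rewrite !mulr1 addr0 add0r.
rewrite !psi_diag2_sandwich //; [|by smr_mem_tac..].
by rewrite !eqxx nji (negbTE nij) !mulr1 !mulr0 !addr0 !add0r.
Qed.

(** By [psi_unit_entries], this means that [E i j] is mapped to a multiple of itself rather than of
    [E j i]. *)
Definition direct i j := [&& P i j, i != j & psi (E i j) j i == 0].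

Definition unit_coef i j := psi (E i j) i j.

Lemma psi_unit_neq0 i j : P i j -> psi (E i j) != 0.
Proof.
move=> Pij; apply/eqP; rewrite -psi0 => /psiI; rewrite rpred0 => /(_ _ _)/matrixP.
move/(_ (smr_mem_delta1 D Pij) isT i j); rewrite !mxE !eqxx => /eqP.
by rewrite oner_eq0.
Qed.

Lemma unit_coef_neq0 i j : direct i j -> unit_coef i j != 0.
Proof.
case/and3P=> Pij nij /eqP E0; apply: contraNneq (psi_unit_neq0 Pij) => c0.
rewrite -[E i j]scale1r psi_unit_entries // scale1r E0 -/(unit_coef i j) c0.
by rewrite !scale0r addr0.
Qed.

Lemma direct_of_neq0 i j : P i j -> i != j -> psi (E i j) i j != 0 -> direct i j.
Proof.
move=> Pij nij c0; rewrite /direct Pij nij /=.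
have := psi_unit_nilp 1 Pij nij; rewrite scale1r => /eqP.
by rewrite div_mulf_eq0 // (negbTE c0).
Qed.

(** Both sides come from [t *: E i j], obtained from [E i j] by scaling row [i] or by scaling column
    [j]. *)
Lemma direct_alpha i j t : direct i j ->
  alpha i t * unit_coef i j = unit_coef i j * alpha j t.
Proof.
case/and3P=> Pij nij _; have [ut _] := psi_unit_scale t 1 1 Pij nij.
have [vt _] := psi_unit_scale 1 1 t Pij nij; move: ut vt.
by rewrite !mulr1 !mul1r !alpha1 scale1r mulr1 mul1r => -> ->.
Qed.

Lemma direct_unit i j t : direct i j ->
  psi (t *: E i j) = (alpha i t * unit_coef i j) *: E i j.
Proof.
case/and3P=> Pij nij /eqP E0; rewrite psi_unit_entries //.
have := psi_unit_scale t 1 1 Pij nij.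
rewrite !mulr1 scale1r E0 alpha1 mulr0 mul0r mulr1 => -[-> ->].
by rewrite scale0r addr0.
Qed.

(* [E i j *m x *m E i j] isolates the entry [x j i]. *)
Lemma direct_rev i j x : direct i j -> x \in R ->
  psi x j i = alpha j (x j i) * (unit_coef i j)^-1.
Proof.
move=> dij xR; have /and3P [Pij nij _] := dij.
have c0 := unit_coef_neq0 dij.
have := direct_unit (x j i) dij; rewrite -[_ *: E i j]delta_sandwich.
rewrite psiJ //; last by smr_mem_tac.
rewrite -[E i j in LHS]scale1r direct_unit // alpha1 mul1r.
rewrite scale_delta_sandwich => /matrixP/(_ i j).
rewrite !mxE !eqxx !mulr1 (direct_alpha _ dij) -mulrA => /(div_lregP divD' c0) <-.
by rewrite mulrK // divD'.
Qed.

(** * Additivity on symmetric pairs, and consequences of equal coefficients *)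

Definition alpha_additive i := {morph alpha i : s t / s + t}.

Definition entry_additive i j :=
  {in R &, forall x y, psi (x + y) i j = psi x i j + psi y i j}.

Lemma direct_alpha_additive i j :
  direct i j -> alpha_additive i <-> alpha_additive j.
Proof.
move=> dij; have c0 := unit_coef_neq0 dij; split=> add s t.
  have : unit_coef i j * alpha j (s + t) =
      unit_coef i j * (alpha j s + alpha j t).
    rewrite mulrDr -(direct_alpha (s + t) dij) -(direct_alpha s dij).
    by rewrite -(direct_alpha t dij) add mulrDl.
  by move/(div_lregP divD' c0).
have : alpha i (s + t) * unit_coef i j =
    (alpha i s + alpha i t) * unit_coef i j.
  rewrite mulrDl (direct_alpha (s + t) dij) (direct_alpha s dij).
  by rewrite (direct_alpha t dij) add mulrDr.
by move/(div_rregP divD' c0).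
Qed.

Lemma direct_rev_additive i j :
  direct i j -> alpha_additive j -> entry_additive j i.
Proof.
move=> dij add x y xR yR; rewrite !(direct_rev dij) ?rpredD //.
by rewrite mxE add mulrDl.
Qed.

Lemma direct_sym i j : direct i j -> P j i -> direct j i.
Proof.
move=> dij Pji; have /and3P [Pij nij _] := dij.
apply: direct_of_neq0 => //; first by rewrite eq_sym.
rewrite (direct_rev dij); last by smr_mem_tac.
rewrite mxE !eqxx alpha1 mul1r; apply/eqP => /(congr1 ( *%R (unit_coef i j))).
by rewrite mulr0 div_mulrV ?unit_coef_neq0 // => /eqP; rewrite oner_eq0.
Qed.

Lemma symmetric_additive i j : direct i j -> P j i -> alpha_additive i.
Proof.
move=> dij Pji s t; have /and3P [Pij nij _] := dij.
have nji : j == i = false by rewrite eq_sym (negbTE nij).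
pose x : 'M[D]_n := E i i + E i j + E j i.
have xR : x \in R by rewrite /x; smr_mem_tac.
have xii : x i i = 1 by rewrite !mxE !eqxx (negbTE nij) !addr0.
have xij : x i j = 1 by rewrite !mxE !eqxx nji (negbTE nij) /= addr0 add0r.
have xji : x j i = 1 by rewrite !mxE !eqxx nji (negbTE nij) /= !add0r.
have := psi_sandwich_diag2 s t i i nij xR.
rewrite psi_diag; last by smr_mem_tac.
rewrite sandwich_diag2 xii xij xji !mulr1 !mul1r (psi_diag i) // xii alpha1.
rewrite (direct_rev dij) // xji alpha1 !mulr1 !mul1r => ->; congr (_ + _).
(* The coefficients of [E i j] and [E j i] are mutually inverse, so the second term is the conjugate
   of [alpha j t] by [unit_coef i j], which is [alpha i t]. *)
have dji := direct_sym dij Pji; rewrite (direct_rev dji) // xij alpha1 mul1r.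
have cV : unit_coef j i = (unit_coef i j)^-1.
  rewrite {1}/unit_coef (direct_rev dij); last by smr_mem_tac.
  by rewrite mxE !eqxx alpha1 mul1r.
by rewrite cV invrK -(direct_alpha _ dij) mulrK // divD' // unit_coef_neq0.
Qed.

(** Once the two coefficients agree, [psi x i j = alpha i (x i j) * unit_coef i j] whether or not
    the diagonal of the block vanishes. *)
Lemma direct_kappa_additive i j : direct i j -> kappa i j = unit_coef i j ->
  alpha_additive i -> ~~ P j i -> entry_additive i j.
Proof.
move=> dij kij add nPji; have /and3P [Pij nij _] := dij.
have ent x : x \in R -> psi x i j = alpha i (x i j) * unit_coef i j.
  move=> xR; have xji := smr_memP _ _ xR _ _ nPji.
  have [x0|x0] := boolP ((x i i != 0) || (x j j != 0)).
    by rewrite psi_kappa // kij.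
  move: x0; rewrite negb_or !negbK => /andP[/eqP xii /eqP xjj].
  rewrite (@psi_local x (x i j *: E i j)) ?direct_unit; smr_mem_tac;
    rewrite !mxE ?eqxx ?mulr1 // ?xji ?xii ?xjj ?(negbTE nij) ?andbF ?mulr0 //.
  by rewrite eq_sym (negbTE nij) mulr0.
by move=> x y xR yR; rewrite !ent ?rpredD // mxE add mulrDl.
Qed.

(** * Additivity along a chain of three distinct indices *)

Section Chain.

Variables (i j k : 'I_n).
Hypotheses (nij : i != j) (njk : j != k) (nik : i != k).
Hypotheses (Pij : P i j) (Pjk : P j k).

Let Pik : P i k. Proof. exact: preord_trans Pij Pjk. Qed.
Let nji : j != i. Proof. by rewrite eq_sym. Qed.
Let nkj : k != j. Proof. by rewrite eq_sym. Qed.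
Let nki : k != i. Proof. by rewrite eq_sym. Qed.
Let chE := (eqxx, negbTE nij, negbTE njk, negbTE nik, negbTE nji, negbTE nkj,
  negbTE nki, @mulmx_sandwich1, @sandwich_diag2, andbF, andbT,
  mulr0, mul0r, mulr1, mul1r, addr0, add0r).

(* The square of [E i j + E j k] is [E i k]. *)
Lemma chain_unit a b : psi (E i k) a b =
  psi (E i j + E j k) a j * psi (E i j + E j k) j b.
Proof.
have xR : E i j + E j k \in R by smr_mem_tac.
rewrite -psi_sandwich //; congr (psi _ a b); apply/matrixP => c d.
by rewrite mulmx_sandwich1 !mxE !chE -natrM mulnb.
Qed.

Hypothesis dij : direct i j.

Let x := E i j + E j k : 'M[D]_n.
Let xR : x \in R. Proof. by rewrite /x; smr_mem_tac. Qed.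
Let x_ij : psi x i j = unit_coef i j.
Proof. by apply: psi_local => //; smr_mem_tac; rewrite !mxE !chE. Qed.
Let x_ji : psi x j i = 0.
Proof. by rewrite (direct_rev dij) // !mxE !chE alpha0 mul0r. Qed.
Let x_jk : psi x j k = unit_coef j k.
Proof. by apply: psi_local => //; smr_mem_tac; rewrite !mxE !chE. Qed.

Lemma chain_coef : unit_coef i k = unit_coef i j * unit_coef j k.
Proof. by rewrite {1}/unit_coef chain_unit -/x x_ij x_jk. Qed.

(** The factor [psi x j i = 0] kills the [(k, i)] entry of [psi (E i k)]. Then [unit_coef i k],
    being nonzero and a product, forces [unit_coef j k] to be nonzero. *)
Lemma chain_direct : direct j k /\ direct i k.
Proof.
have ki0 : psi (E i k) k i = 0 by rewrite chain_unit -/x x_ji mulr0.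
have dik : direct i k by rewrite /direct Pik nik ki0 eqxx.
split=> //; apply: direct_of_neq0 => //; rewrite -/(unit_coef j k).
apply: contraNneq (unit_coef_neq0 dik) => c0.
by rewrite chain_coef c0 mulr0.
Qed.

Let djk := proj1 chain_direct.
Let dik := proj2 chain_direct.

(** For [y = E_ii + E_ij + E_jk], [y E_jj y = E_ik]. The diagonal of [y] is nonzero on the block
    [i, j] and zero on [j, k], so [kappa i j * unit_coef j k = unit_coef i k]. *)
Lemma chain_kappa_left : kappa i j = unit_coef i j.
Proof.
pose y : 'M[D]_n := E i i + x.
have yR : y \in R by apply: smr_memD => //; smr_mem_tac.
have := psi_sandwich j i k yR.
have -> : psi y i j = kappa i j.
  by rewrite psi_kappa // /y /x !mxE !chE ?oner_neq0 ?orbT ?alpha1 ?mul1r.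
have -> : psi y j k = unit_coef j k.
  by apply: psi_local; smr_mem_tac; rewrite /y /x !mxE !chE.
have -> : psi (y *m E j j *m y) i k = unit_coef i k.
  by apply: psi_local; smr_mem_tac; rewrite ?mulmx_sandwich1 /y /x !mxE !chE.
by rewrite chain_coef => /(div_rregP divD' (unit_coef_neq0 djk)).
Qed.

Lemma chain_kappa_right : kappa j k = unit_coef j k.
Proof.
pose y : 'M[D]_n := E k k + x.
have yR : y \in R by apply: smr_memD => //; smr_mem_tac.
have := psi_sandwich j i k yR.
have -> : psi y j k = kappa j k.
  by rewrite psi_kappa // /y /x !mxE !chE ?oner_neq0 ?orbT ?alpha1 ?mul1r.
have -> : psi y i j = unit_coef i j.
  by apply: psi_local; smr_mem_tac; rewrite /y /x !mxE !chE.
have -> : psi (y *m E j j *m y) i k = unit_coef i k.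
  by apply: psi_local; smr_mem_tac; rewrite ?mulmx_sandwich1 /y /x !mxE !chE.
by rewrite chain_coef => /(div_lregP divD' (unit_coef_neq0 dij)).
Qed.

(** The path through [j] contributes [s] with the coefficient [unit_coef i j * unit_coef j k =
    unit_coef i k]; the path staying at [i] contributes [t] with [kappa i k]. The case [s = 1],
    [t = 0] then identifies the two coefficients. *)
Lemma chain_sum s t : alpha i (s + t) * kappa i k =
  alpha i s * unit_coef i k + alpha i t * kappa i k.
Proof.
pose y : 'M[D]_n := E i i + s *: E i j + t *: E i k + E j k.
have yR : y \in R by rewrite /y; smr_mem_tac.
have := psi_sandwich_diag2 1 1 i k nij yR; rewrite !alpha1 !mulr1.
have -> : psi y i i = 1 by rewrite psi_diag // !mxE !chE alpha1.
have -> : psi y i k = alpha i t * kappa i k.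
  by rewrite psi_kappa // !mxE !chE ?oner_neq0.
have -> : psi y j k = unit_coef j k.
  by apply: psi_local; smr_mem_tac; rewrite /y !mxE !chE.
have -> : psi y i j = alpha i s * unit_coef i j.
  by rewrite -chain_kappa_left psi_kappa // !mxE !chE ?oner_neq0.
rewrite -mulrA -chain_coef mul1r addrC => <-.
rewrite psi_kappa //; smr_mem_tac; rewrite !sandwich_diag2 !mxE !chE ?oner_neq0 //.
by rewrite addrC.
Qed.

Lemma chain_kappa : kappa i k = unit_coef i k.
Proof. by have := chain_sum 1 0; rewrite addr0 alpha0 alpha1 !mul1r mul0r addr0. Qed.

Lemma chain_alpha_additive : alpha_additive i.
Proof.
move=> s t; have := chain_sum s t; rewrite chain_kappa -mulrDl.
exact: div_rregP (unit_coef_neq0 dik) _ _.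
Qed.

(** The list covers the three positions of a pair in a chain, one for each alternative in
    [nonisolated]. *)
Lemma chain_additive p q :
    (p, q) \in [:: (i, j); (j, k); (i, k)] -> ~~ P q p ->
  [/\ alpha_additive p, alpha_additive q, entry_additive p q &
    entry_additive q p].
Proof.
move=> pq nPqp.
have addi := chain_alpha_additive.
have addj := (direct_alpha_additive dij).1 addi.
have addk := (direct_alpha_additive dik).1 addi.
suff [dpq addp addq kpq] : [/\ direct p q, alpha_additive p, alpha_additive q &
    kappa p q = unit_coef p q].
  split=> //; first exact: direct_kappa_additive.
  exact: direct_rev_additive.
move: pq; rewrite !inE => /or3P[] /eqP[-> ->]; split=> //.
- exact: chain_kappa_left.
- exact: chain_kappa_right.
- exact: chain_kappa.
Qed.

End Chain.

End Normalized.

(** Transposition over the converse ring reverses products, and [x y x] reads the same backwards. *)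
Lemma normalized_jst_tr (D D' : unitRingType) n (P : preord n)
    (psi : 'M[D]_n -> 'M[D']_n) : normalized_jst P psi ->
  normalized_jst P (fun x => (psi x)^T : 'M[D'^c]_n).
Proof.
have trM (A B : 'M[D']_n) : (A *m B)^T = (B^T : 'M[D'^c]_n) *m (A^T : 'M[D'^c]_n).
  exact: trmx_mul_rev.
case=> psiJ psiI psi0 psi1 psiE; split.
- by move=> x y xR yR; rewrite psiJ // -mulmxA !trM.
- by move=> x y xR yR /trmx_inj/psiI; apply.
- by rewrite psi0 trmx0.
- by rewrite psi1 trmx1.
- by move=> i; rewrite psiE trmx_delta.
Qed.

(** * Additivity on every comparable pair *)

Section NormalizedAdditive.

Variables (D D' : unitRingType) (divD' : division_ring D').
Variables (n : nat) (P : preord n) (psi : 'M[D]_n -> 'M[D']_n).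
Hypothesis npsi : normalized_jst P psi.

Let psiT (x : 'M[D]_n) : 'M[D'^c]_n := (psi x)^T.
Let npsiT : normalized_jst P psiT := normalized_jst_tr npsi.
Let divD'c := division_ring_converse divD'.

(* By [psi_unit_nilp] a matrix unit is mapped to a multiple of itself or of its
   transpose; the second case reduces to the first one over the converse ring. *)
Lemma direct_or_tr i j : P i j -> i != j -> direct P psi i j || direct P psiT i j.
Proof.
move=> Pij nij; have := psi_unit_nilp npsi 1 Pij nij.
rewrite scale1r => /eqP; rewrite div_mulf_eq0 // orbC.
by rewrite /direct Pij nij /psiT mxE.
Qed.

Lemma alphaT i t : alpha psiT i t = alpha psi i t.
Proof. by rewrite /alpha /psiT mxE. Qed.

Lemma alpha_additiveT i : alpha_additive psiT i -> alpha_additive psi i.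
Proof. by move=> add s t; rewrite -!alphaT add. Qed.

Lemma entry_additiveT i j : entry_additive P psiT i j -> entry_additive P psi j i.
Proof. by move=> add x y xR yR; have := add x y xR yR; rewrite /psiT !mxE. Qed.

Lemma pair_additive i j : P i j -> i != j ->
    (nonsymmetric_pair P i j -> nonisolated P i j) ->
  [/\ alpha_additive psi i, alpha_additive psi j, entry_additive P psi i j &
    entry_additive P psi j i].
Proof.
move=> Pij nij nonisol; have [Pji|nPji] := boolP (P j i).
  have /orP[dij|dij] := direct_or_tr Pij nij.
    have dji := direct_sym divD' npsi dij Pji.
    have addi := symmetric_additive divD' npsi dij Pji.
    have addj := symmetric_additive divD' npsi dji Pij.
    by split=> //; [exact: direct_rev_additive dji _|exact: direct_rev_additive dij _].
  have dji := direct_sym divD'c npsiT dij Pji.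
  have addi := symmetric_additive divD'c npsiT dij Pji.
  have addj := symmetric_additive divD'c npsiT dji Pij.
  by split; [exact: alpha_additiveT|exact: alpha_additiveT
    |apply: entry_additiveT; exact: direct_rev_additive dij _
    |apply: entry_additiveT; exact: direct_rev_additive dji _].
have chain a b c : a != b -> b != c -> a != c -> P a b -> P b c ->
    (i, j) \in [:: (a, b); (b, c); (a, c)] ->
    [/\ alpha_additive psi i, alpha_additive psi j, entry_additive P psi i j &
      entry_additive P psi j i].
  (* Directness is tested on the first pair of the chain, which need not be [(i, j)]; it propagates
     to the other two by [chain_direct]. *)
  move=> nab nbc nac Pab Pbc ijabc; have /orP[dab|dab] := direct_or_tr Pab nab.
    exact: (chain_additive divD' npsi nab nbc nac Pab Pbc dab ijabc nPji).
  have [addi addj addij addji] :=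
    chain_additive divD'c npsiT nab nbc nac Pab Pbc dab ijabc nPji.
  by split; [exact: alpha_additiveT|exact: alpha_additiveT
    |exact: entry_additiveT|exact: entry_additiveT].
have [|k [ki kj /or3P[]/andP[Pa Pb]]] := nonisol; first exact/andP.
- by apply: (chain k i j); rewrite // !inE eqxx ?orbT.
- by apply: (chain i k j); rewrite // 1?eq_sym // !inE eqxx ?orbT.
- by apply: (chain i j k); rewrite // 1?eq_sym // !inE eqxx ?orbT.
Qed.

End NormalizedAdditive.

(** * Diagonal idempotents indexed by sets *)

Section SetProjection.

Variables (D : unitRingType) (n : nat) (P : preord n).
Implicit Types A B : {set 'I_n}.

Definition set_mx A : 'M[D]_n := diag_mx (\row_l (l \in A)%:R).

Lemma set_mxM A B : set_mx A *m set_mx B = set_mx (A :&: B).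
Proof.
rewrite mulmx_diag; congr diag_mx; apply/rowP => l; rewrite !mxE inE.
by case: (l \in A); rewrite ?mul1r ?mul0r.
Qed.

Lemma set_mx_inj : injective set_mx.
Proof.
move=> A B /matrixP AB; apply/setP => l; have := AB l l.
rewrite !mxE eqxx; case: (l \in A); case: (l \in B) => // /eqP.
  by rewrite oner_eq0.
by rewrite eq_sym oner_eq0.
Qed.

Lemma set_mx0 : set_mx set0 = 0.
Proof. by apply/matrixP => a b; rewrite !mxE inE mul0rn. Qed.

Lemma set_mxT : set_mx setT = 1%:M.
Proof. by apply/matrixP => a b; rewrite !mxE inE. Qed.

Lemma set_mx1 i : set_mx [set i] = delta_mx i i.
Proof.
apply/matrixP => a b; rewrite !mxE inE; have [<-|ab] := eqVneq a b.
  by rewrite andbb.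
by case: eqP => //= <-; rewrite eq_sym (negbTE ab).
Qed.

Lemma smr_mem_set A : set_mx A \in smr_mem P.
Proof.
apply/smr_memP => i j nPij; rewrite !mxE; case: eqP => // eij.
by rewrite eij preord_refl in nPij.
Qed.

End SetProjection.

(** * Frames of orthogonal idempotents in the image *)

Section Frame.

Variables (D : unitRingType) (divD : division_ring D).
Variables (n : nat) (P : preord n) (psi : 'M[D]_n -> 'M[D]_n).

Local Notation R := (smr_mem (D := D) P).

Hypothesis psiJ : forall x y, x \in R -> y \in R ->
  psi (x *m y *m x) = psi x *m psi y *m psi x.
Hypothesis psiI : {in R &, injective psi}.

Let p A := psi (set_mx D A).
(** [p A] is only known to equal its own cube; its square is idempotent. *)
Let q A := p A *m p A.

Let pS (A B : {set 'I_n}) : A \subset B ->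
  p A = p B *m p A *m p B /\ p A = p A *m p B *m p A.
Proof.
move=> AB; rewrite /p -!psiJ ?smr_mem_set // !set_mxM.
by rewrite (setIidPr AB) (setIidPl AB) setIid.
Qed.

Let q_p (A B : {set 'I_n}) :
  A \subset B -> q B *m p A = p A /\ p A *m q B = p A.
Proof.
move=> AB; have [pA _] := pS AB; have [pB _] := pS (subxx B).
split; first by rewrite [in LHS]pA /q !mulmxA -pB -pA.
by rewrite [in LHS]pA /q -!mulmxA [p B *m (p B *m p B)]mulmxA -pB mulmxA -pA.
Qed.

Let q_q (A B : {set 'I_n}) :
  A \subset B -> q B *m q A = q A /\ q A *m q B = q A.
Proof.
move=> /q_p[qp pq]; split; first by rewrite {2}/q mulmxA qp.
by rewrite {1}/q -mulmxA pq.
Qed.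

(** Equality of the squares turns [p A = p A p B p A] into [p B p A = q B], whence
    [p A = q B p A = p B q B = p B]. Thus [q] is strictly increasing. *)
Let q_inj (A B : {set 'I_n}) : A \subset B -> q A = q B -> A = B.
Proof.
move=> AB qAB; have [pA pA'] := pS AB; have [qp _] := q_p AB.
have [qpB _] := q_p (subxx B).
have pBA : p B *m p A = q B.
  have : p A *m p A = p A *m (p A *m p B *m p A) by rewrite -pA'.
  by rewrite !mulmxA -/(q A) qAB qpB.
have : p A = p B by rewrite -qp {1}/q -mulmxA pBA /q mulmxA -(pS (subxx B)).1.
by move/psiI => /(_ (smr_mem_set D P A) (smr_mem_set D P B))/set_mx_inj.
Qed.

(* The sets [U l], ordered by [r], form a maximal flag. *)
Section Flag.

Variables (r : 'I_n -> nat) (r_inj : injective r).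

Let L l := [set m | (r m < r l)%N].
Let U l := [set m | (r m <= r l)%N].

Let LU l : L l \subset U l.
Proof. by apply/subsetP => m; rewrite !inE => /ltnW. Qed.

Let UL l m : (r l < r m)%N -> U l \subset L m.
Proof. by move=> lm; apply/subsetP => k; rewrite !inE => /leq_ltn_trans; apply. Qed.

(** Consecutive differences in an increasing family of idempotents are orthogonal idempotents; they
    are nonzero by [q_inj], since [U l] contains [l] and [L l] does not. *)
Lemma flag_frame : exists T T', [/\ T *m T' = 1%:M, T' *m T = 1%:M &
  forall l, q (U l) - q (L l) = T *m delta_mx l l *m T'].
Proof.
apply: orthogonal_idempotents => // [l|l|l m lm].
- rewrite subr_eq0 eq_sym; apply/eqP => /(q_inj (LU l))/setP/(_ l).
  by rewrite !inE ltnn leqnn.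
- have [UL1 UL2] := q_q (LU l); have [LL _] := q_q (subxx (L l)).
  have [UU _] := q_q (subxx (U l)).
  by rewrite mulmxBl !mulmxBr UL1 UL2 LL UU subrr subr0.
have : (r l < r m)%N || (r m < r l)%N by rewrite -neq_ltn (inj_eq r_inj).
case/orP => /UL sub.
  have [_ UL2] := q_q sub; have [_ LL2] := q_q (subset_trans (LU l) sub).
  have [_ UU2] := q_q (subset_trans sub (LU m)).
  have [_ LU2] := q_q (subset_trans (subset_trans (LU l) sub) (LU m)).
  by rewrite mulmxBl !mulmxBr UL2 LL2 UU2 LU2 !subrr.
have [UL2 _] := q_q sub; have [LL2 _] := q_q (subset_trans (LU m) sub).
have [UU2 _] := q_q (subset_trans sub (LU l)).
have [LU2 _] := q_q (subset_trans (subset_trans (LU m) sub) (LU l)).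
by rewrite mulmxBl !mulmxBr UL2 LL2 UU2 LU2 !subrr.
Qed.

Lemma flag_eq0 (X : 'M[D]_n) : (forall l, X *m (q (U l) - q (L l)) = 0) -> X = 0.
Proof.
have [T [T' [TT' T'T fT]]] := flag_frame; move=> X0.
suff XT : X *m T = 0 by rewrite -[X]mulmx1 -TT' mulmxA XT mul0mx.
apply/matrixP => a l; have /(congr1 (mulmxr T))/matrixP/(_ a l) := X0 l.
rewrite fT /= !mulmxA -mulmxA T'T mulmx1 mul0mx -[delta_mx l l]scale1r.
by rewrite mulmx_delta_r eqxx !mulr1 !mxE.
Qed.

End Flag.

(** [q set0] and [1 - q setT] annihilate every difference along the flag of the natural order, hence
    vanish. *)
Let psi0_psi1 : psi 0 = 0 /\ psi 1%:M *m psi 1%:M = 1%:M.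
Proof.
have sub0 A : q set0 *m q A = q set0 by case: (q_q (sub0set A)).
have subT A : q setT *m q A = q A by case: (q_q (subsetT A)).
have q0 : q set0 = 0.
  by apply: (flag_eq0 val_inj) => l; rewrite mulmxBr !sub0 subrr.
have qT : 1%:M - q setT = 0.
  apply: (flag_eq0 val_inj) => l.
  by rewrite mulmxBl mul1mx mulmxBr !subT subrr.
split; last by move/eqP: qT; rewrite subr_eq0 /q /p set_mxT => /eqP.
by have [+ _] := q_p (subxx set0); rewrite q0 mul0mx /p set_mx0.
Qed.

Lemma jst_zero : psi 0 = 0. Proof. by case: psi0_psi1. Qed.

Lemma jst_one : psi 1%:M *m psi 1%:M = 1%:M. Proof. by case: psi0_psi1. Qed.

Lemma jst_rank1 i : exists T T', [/\ T *m T' = 1%:M, T' *m T = 1%:M &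
  psi (delta_mx i i) *m psi (delta_mx i i) = T *m delta_mx i i *m T'].
Proof.
(* This flag starts with [i], so that [L i] is empty and [U i = [set i]]. *)
pose r (l : 'I_n) := if l == i then 0%N else l.+1.
have r_inj : injective r.
  move=> k l; rewrite /r; case: eqP => [->|_]; case: eqP => [->|_] //.
  by case=> /val_inj.
have [T [T' [TT' T'T fT]]] := flag_frame r_inj; exists T, T'; split=> //.
rewrite -fT /q /p (_ : finset _ = [set i]); last first.
  apply/setP => m; rewrite !inE /r eqxx leqn0; case: (m == i); by rewrite ?eqxx.
rewrite (_ : finset _ = set0); last first.
  by apply/setP => m; rewrite !inE /r eqxx.
by rewrite set_mx0 set_mx1 jst_zero mul0mx subr0.
Qed.

End Frame.

(** * Reduction to a normalized map *)

Lemma exists_neq01 (D : unitRingType) : has_more_than 2 D ->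
  exists2 t : D, t != 0 & t != 1.
Proof.
case=> s [us s2]; have [/hasP [t _ /andP[]]|/hasPn ns] :=
  boolP (has (fun t : D => (t != 0) && (t != 1)) s); first by exists t.
have /(uniq_leq_size us) : {subset s <= [:: 0; 1]}.
  by move=> t /ns; rewrite negb_and !negbK !inE.
by rewrite leqNgt s2.
Qed.

Section Normalization.

Variables (D : unitRingType) (divD : division_ring D).
Hypothesis D_gt2 : has_more_than 2 D.
Variables (n : nat) (P : preord n).

Local Notation R := (smr_mem (D := D) P).
Local Notation E i j := (delta_mx i j).

(** In a frame where [e = psi (E i i)] is a diagonal unit, [p = psi (t *: E i i)] becomes
    [a *: E i i]. Injectivity and the choice of [t] exclude [a = 0] and [a = 1], so [p p f = p f]
    forces [e f = 0]. *)
Lemma unital_orthogonal (psi : 'M[D]_n -> 'M[D]_n) :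
    (forall x y, x \in R -> y \in R ->
       psi (x *m y *m x) = psi x *m psi y *m psi x) ->
    {in R &, injective psi} -> psi 1%:M = 1%:M ->
  forall i j, i != j -> psi (E i i) *m psi (E j j) = 0.
Proof.
move=> psiJ psiI psi1 i j nij; have psi0 := jst_zero divD psiJ psiI.
have nji : j == i = false by rewrite eq_sym (negbTE nij).
have [t t0 t1] := exists_neq01 D_gt2.
have psi2 x : x \in R -> psi (x *m x) = psi x *m psi x.
  by move=> xR; have := psiJ x 1%:M xR (rpred1 _); rewrite psi1 !mulmx1.
have idem k : psi (E k k) *m psi (E k k) = psi (E k k).
  by rewrite -psi2 ?mul_delta_mx //; smr_mem_tac.
have [T [T' [TT' T'T eT]]] := jst_rank1 divD psiJ psiI i; rewrite idem in eT.
set e := psi (E i i) in eT *; set f := psi (E j j).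
pose y := psi (diag2 i j t 1); pose p := psi (t *: E i i).
have [eR fR] : E i i \in R /\ E j j \in R by split; smr_mem_tac.
have [dR tR] : diag2 i j t 1 \in R /\ t *: E i i \in R by split; smr_mem_tac.
have yfy : y *m f *m y = f.
  rewrite -psiJ //; congr psi; apply/matrixP => a b.
  rewrite diag2_sandwich !mxE; have [->|] := eqVneq a j => /=; last first.
    by rewrite !mulr0 mul0r.
  by have [->|] := eqVneq b j; rewrite /= ?nji ?mulr0 ?add0r ?mulr1 ?mul0r.
have fyf : f *m y *m f = f.
  by rewrite -psiJ // delta_sandwich diag2E nji !eqxx mulr0 add0r !mulr1 scale1r.
have yf : y *m f = f.
  by rewrite -[in LHS]fyf !mulmxA yfy idem.
have eye : e *m y *m e = p.
  rewrite -psiJ // delta_sandwich diag2E !eqxx (negbTE nij) mulr0 addr0.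
  by rewrite !mulr1.
have pp : p *m p = y *m e *m y.
  rewrite -psi2 // -psiJ //; congr psi; apply/matrixP => a b.
  rewrite diag2_sandwich mulmx_delta_r !mxE.
  by have [->|_] := eqVneq a i; have [->|_] := eqVneq b i;
    rewrite ?eqxx ?(negbTE nij) /= ?(mulr0, mul0r, mulr1, mul1r, addr0).
have pe : p *m e = p by rewrite -eye -mulmxA idem.
have ep : e *m p = p by rewrite -eye !mulmxA idem.
(* Since [e p = p], [p p f = e (p p f) = e (y e y f) = e y e f = p f]. *)
have ppf : p *m p *m f = p *m f.
  have yef : p *m p *m f = y *m e *m f by rewrite pp -mulmxA yf.
  have -> : p *m p *m f = e *m (p *m p *m f) by rewrite !mulmxA ep.
  by rewrite yef !mulmxA eye.
pose a := (T' *m p *m T) i i.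
have pT : p = T *m (a *: E i i) *m T'.
  rewrite -delta_sandwich -[in LHS]pe -[in LHS]ep eT.
  by rewrite !mulmxA.
have T_inj (X Y : 'M[D]_n) : T *m X = T *m Y -> X = Y.
  by move/(congr1 (mulmx T')); rewrite !mulmxA T'T !mul1mx.
have aaE : (a *: E i i) *m (a *: E i i) = (a * a) *: E i i :> 'M[D]_n.
  by rewrite -[X in X *m _]mulmx1 scale_delta_sandwich mxE eqxx mulr1.
have ppT : p *m p = T *m ((a * a) *: E i i) *m T'.
  by rewrite pT -!mulmxA (mulmxA T') T'T mul1mx (mulmxA (a *: _)) aaE.
have Ef : (a * a - a) *: (E i i *m T' *m f) = 0.
  apply: T_inj; rewrite 2!scalemxAl scalerBl !mulmxBl mulmxBr mulmx0 !mulmxA.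
  by rewrite -ppT ppf pT subrr.
have a0 : a != 0.
  apply: contraNneq t0 => a0; move: pT; rewrite a0 scale0r mulmx0 mul0mx.
  rewrite -psi0 => /psiI; rewrite rpred0 => /(_ _ _)/matrixP/(_ i i).
  by rewrite !mxE !eqxx mulr1 => ->.
have a1 : a != 1.
  apply: contraNneq t1 => a1; move: pT; rewrite a1 scale1r -eT.
  by move/psiI => /(_ _ _)/matrixP/(_ i i); rewrite !mxE !eqxx mulr1 => ->.
have ua : a * a - a \is a GRing.unit.
  apply: divD; rewrite -{3}[a]mulr1 -mulrBr div_mulf_eq0 //.
  by rewrite negb_or a0 subr_eq0.
have {}Ef : E i i *m T' *m f = 0.
  have := congr1 ( *:%R (a * a - a)^-1) Ef.
  by rewrite scalerA mulVr // scale1r scaler0.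
by rewrite eT -!mulmxA [E i i *m _]mulmxA Ef mulmx0.
Qed.

(** [v = psi 1] is an involution commuting with the image, so [v psi] is a unital semi-triple map; a
    base change then makes the images of the [E i i] diagonal units. The one-sided inverses suffice
    to recover [psi]. *)
Lemma jst_normalize (psi : 'M[D]_n -> 'M[D]_n) :
    (forall x y, x \in R -> y \in R ->
       psi (x *m y *m x) = psi x *m psi y *m psi x) ->
    {in R &, injective psi} ->
  exists A A' B B', [/\ A' *m A = 1%:M, B *m B' = 1%:M &
    normalized_jst P (fun x => A *m psi x *m B)].
Proof.
move=> psiJ psiI; set v := psi 1%:M.
have vv : v *m v = 1%:M := jst_one divD psiJ psiI.
have vC x : x \in R -> v *m psi x = psi x *m v.
  move=> xR; have := psiJ 1%:M x (rpred1 _) xR; rewrite mul1mx mulmx1 -/v => vx.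
  by rewrite [in LHS]vx !mulmxA vv mul1mx.
pose psi' x := v *m psi x.
have v_inj (X Y : 'M[D]_n) : v *m X = v *m Y -> X = Y.
  by move/(congr1 (mulmx v)); rewrite !mulmxA vv !mul1mx.
have psiJ' x y : x \in R -> y \in R ->
    psi' (x *m y *m x) = psi' x *m psi' y *m psi' x.
  move=> xR yR; rewrite /psi' psiJ // !mulmxA; congr (_ *m psi x).
  by rewrite -!mulmxA -(vC y) // [v *m (v *m _)]mulmxA vv mul1mx.
have psiI' : {in R &, injective psi'} by move=> x y xR yR /v_inj/psiI; apply.
have psi1' : psi' 1%:M = 1%:M by [].
have psi0' := jst_zero divD psiJ' psiI'.
have [||i j|T [T' [TT' T'T eT]]] :=
    @orthogonal_idempotents D divD n (fun i => psi' (E i i)).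
- move=> i; apply/eqP; rewrite -psi0' => /psiI'; rewrite rpred0.
  move=> /(_ (smr_mem_delta1 D (preord_refl P i)) isT)/matrixP/(_ i i).
  by rewrite !mxE !eqxx => /eqP; rewrite oner_eq0.
- move=> i; rewrite -[psi' _ *m psi' _]mulmx1 -[in LHS]psi1'.
  rewrite -mulmxA -[psi' _ *m psi' 1%:M]mulmx1.
  have := psiJ' (E i i) 1%:M (smr_mem_delta1 D (preord_refl P i)) (rpred1 _).
  by rewrite psi1' !mulmx1 mul_delta_mx => <-.
- exact: unital_orthogonal.
exists (T' *m v), (v *m T), T, T'; split=> //.
  by rewrite mulmxA -(mulmxA v) TT' mulmx1.
have psiE x : T' *m v *m psi x *m T = T' *m psi' x *m T.
  by rewrite /psi' mulmxA.
split=> [x y xR yR|x y xR yR||  |i]; rewrite !psiE.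
- have TK (X : 'M[D]_n) : T *m (T' *m X) = X by rewrite mulmxA TT' mul1mx.
  by rewrite psiJ' // -!mulmxA !TK.
- move=> /(congr1 (mulmx T)); rewrite !mulmxA TT' !mul1mx.
  by move=> /(congr1 (mulmxr T')); rewrite /= -!mulmxA TT' !mulmx1 => /psiI'; apply.
- by rewrite psi0' mulmx0 mul0mx.
- by rewrite psi1' mulmx1.
by rewrite eT !mulmxA T'T mul1mx -mulmxA T'T mulmx1.
Qed.

End Normalization.

(** * Semi-triple maps of the fields with 3 and 4 elements *)

Lemma GF3_elements (D : unitRingType) : isomorphic_to_GF 3 D ->
  forall x : D, [\/ x = 0, x = 1 | x = -1].
Proof.
case=> F [f [cF /bij_inj f_inj]] x; have := expf_card (f x).
rewrite cF => fx3; have [fx0|fx0] := eqVneq (f x) 0.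
  by constructor 1; apply: f_inj; rewrite rmorph0.
have /eqP : f x ^+ 2 = 1 by apply: (mulfI fx0); rewrite -exprS fx3 mulr1.
rewrite sqrf_eq1 => /orP[]/eqP fx1; [constructor 2|constructor 3];
  by apply: f_inj; rewrite ?rmorphN rmorph1.
Qed.

(** The identity [y ^ 4 = y] gives [-1 = 1] and makes every element other than 0 and 1 a root of
    [y ^ 2 = y + 1], whose roots differ by 1. *)
Lemma GF4_elements (D : unitRingType) : isomorphic_to_GF 4 D ->
  (-1 = 1 :> D) /\ forall x : D, x != 0 -> x != 1 ->
  x * x = x + 1 /\ (forall y, y != 0 -> y != 1 -> y = x \/ y = x + 1).
Proof.
case=> F [f [cF /bij_inj f_inj]].
have F4 y : y ^+ 4 = y :> F by rewrite -cF expf_card.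
have N1 : -1 = 1 :> F by rewrite -[LHS]F4 -signr_odd expr0.
have NN (y : F) : - y = y by rewrite -mulN1r N1 mul1r.
have root (y : D) : y != 0 -> y != 1 -> f y * f y = f y + 1.
  rewrite -!(inj_eq f_inj) rmorph0 rmorph1 => y0 y1; apply/eqP.
  have /eqP : f y * ((f y - 1) * (f y * f y + (f y + 1))) = 0.
    by have /eqP := F4 (f y); rewrite -subr_eq0 => /eqP <-; ring.
  by rewrite !mulf_eq0 (negbTE y0) subr_eq0 (negbTE y1) /= addr_eq0 NN.
split; first by apply: f_inj; rewrite rmorphN rmorph1.
move=> x x0 x1; split=> [|y y0 y1].
  by apply: f_inj; rewrite rmorphM rmorphD rmorph1 root.
have /eqP : (f y - f x) * (f y - (f x + 1)) = 0.
  (* The last summand is a multiple of 2 and vanishes in characteristic 2; the first two vanish by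
     [root]. *)
  have -> : (f y - f x) * (f y - (f x + 1)) = (f y * f y - (f y + 1)) +
      (f x * f x - (f x + 1)) + (1 + 1) * (1 + f x - f x * f y) by ring.
  have two0 : 1 + 1 = 0 :> F by rewrite -{2}N1 subrr.
  by rewrite !root // two0 !subrr mul0r !addr0.
rewrite mulf_eq0 !subr_eq0 => /orP[]/eqP yx; [left|right]; apply: f_inj => //.
by rewrite rmorphD rmorph1.
Qed.

Section SmallFields.

Variables (D : unitRingType) (a : D -> D).
Hypotheses (a0 : a 0 = 0) (a1 : a 1 = 1) (a_inj : injective a).
Hypothesis aJ : forall s t, a (s * t * s) = a s * a t * a s.

(** As 0 and 1 are fixed, injectivity leaves only [-1] for the image of [-1], and [a] is the
    identity. *)
Lemma GF3_jst_additive : isomorphic_to_GF 3 D -> {morph a : s t / s + t}.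
Proof.
move/GF3_elements => D01.
have aN1 : a (-1) = -1.
  have [/eqP|aN|//] := D01 (a (-1)).
    by rewrite -a0 (inj_eq a_inj) oppr_eq0 oner_eq0.
  by have := aN; rewrite -a1 => /a_inj ->.
have aN x : a (- x) = - a x.
  by case: (D01 x) => ->; rewrite ?opprK ?a1 ?aN1 ?opprK ?oppr0 ?a0 ?oppr0.
have a2 : a (1 + 1) = 1 + 1 by case: (D01 (1 + 1)) => ->.
move=> s t; case: (D01 s) => ->; case: (D01 t) => ->;
  rewrite ?(add0r, addr0, subrr, addNr, a0, a1, aN1) //.
by rewrite -opprD aN a2 opprD.
Qed.

(** For [x] other than 0 and 1, [x + 1] is the square of [x], so [a (x + 1) = a x * a x = a x + 1].
    Two such elements are equal or differ by 1, which leaves only sums with 0, 1 or an equal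
    term. *)
Lemma GF4_jst_additive : isomorphic_to_GF 4 D -> {morph a : s t / s + t}.
Proof.
case/GF4_elements => N1 D4.
have xx (x : D) : x + x = 0 by rewrite -{2}[x]mul1r -N1 mulN1r subrr.
have as1 x : a (x + 1) = a x + 1.
  have [->|x0] := eqVneq x 0; first by rewrite a0 !add0r.
  have [->|x1] := eqVneq x 1; first by rewrite a1 xx.
  have [<- _] := D4 x x0 x1; have := aJ x 1; rewrite a1 !mulr1 => ->.
  have ax0 : a x != 0 by rewrite -a0 (inj_eq a_inj).
  have ax1 : a x != 1 by rewrite -a1 (inj_eq a_inj).
  by have [] := D4 _ ax0 ax1.
move=> s t; have [->|s0] := eqVneq s 0; first by rewrite a0 !add0r.
have [->|s1] := eqVneq s 1; first by rewrite addrC as1 a1 addrC.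
have [->|t0] := eqVneq t 0; first by rewrite a0 !addr0.
have [->|t1] := eqVneq t 1; first by rewrite as1 a1.
have [_ /(_ t t0 t1)[->|->]] := D4 s s0 s1; first by rewrite !xx.
by rewrite as1 !addrA !xx !add0r.
Qed.

End SmallFields.

(** * Additivity, checked on each matrix entry *)

Theorem proposition4p10 (D : unitRingType) (D_division : division_ring D)
    (D_gt2 : has_more_than 2 D) (n : nat) (n_ge2 : (2 <= n)%N) (P : preord n)
    (phi : smr D P -> 'M[D]_n) (phi_inj : injective phi)
    (phi_jordan : jordan_semi_triple phi)
    (P_nonisolated :
       forall i j : 'I_n, nonsymmetric_pair P i j -> nonisolated P i j)
    (P_singleton :
       has_singleton_component P ->
       isomorphic_to_GF 3 D \/ isomorphic_to_GF 4 D) :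
  {morph phi : x y / x + y}.
Proof.
(* [phi] is extended to all matrices, with the value [phi 0] outside the ring. *)
pose F (A : 'M[D]_n) := phi (insubd 0 A).
have Fval x : F (val x) = phi x by rewrite /F valKd.
have FJ x y : x \in smr_mem P -> y \in smr_mem P ->
    F (x *m y *m x) = F x *m F y *m F x.
  move=> xR yR; pose u := SMR xR; pose v := SMR yR.
  rewrite -[x]/(val u) -[y]/(val v) -[_ *m _ *m _]/(val (u * v * u)) !Fval.
  exact: phi_jordan.
have FI : {in smr_mem P &, injective F}.
  move=> x y xR yR; rewrite -[x]/(val (SMR xR)) -[y]/(val (SMR yR)) !Fval.
  by move/phi_inj => ->.
have [A [A' [B [B' [A'A BB' norm]]]]] := jst_normalize D_division D_gt2 FJ FI.
set psi := fun x => A *m F x *m B in norm.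
suff add : {in smr_mem P &, forall x y, psi (x + y) = psi x + psi y}.
  have phiE x : phi x = A' *m psi (val x) *m B'.
    by rewrite /psi Fval !mulmxA A'A mul1mx -mulmxA BB' mulmx1.
  move=> x y; rewrite !phiE -mulmxDl -mulmxDr -add //; exact: valP.
have addP i j : P i j -> i != j ->
    [/\ alpha_additive psi i, alpha_additive psi j, entry_additive P psi i j &
      entry_additive P psi j i].
  by move=> Pij nij; apply: pair_additive => //; apply: P_nonisolated.
(* An index with a neighbour belongs to a comparable pair; one without is a singleton component,
   where the ring has 3 or 4 elements. *)
have add_alpha i : alpha_additive psi i.
  have [/existsP [j /andP[nij /orP[] Pij]]|/existsPn isol] :=
    boolP [exists j, comparability P i j].
  - by have [] := addP i j Pij nij.
  - by have [] := addP j i Pij; rewrite 1?eq_sym.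
  have [|GF|GF] := P_singleton.
  - exists i; apply/setP => j; rewrite !inE; apply/connectP/eqP => [[]|->].
      by case=> [//|k s] /= /andP[]; rewrite (negbTE (isol k)).
    by exists [::].
  - exact: GF3_jst_additive (alpha0 norm i) (alpha1 norm i)
      (@alpha_inj _ _ _ _ _ norm i) GF.
  exact: GF4_jst_additive (alpha0 norm i) (alpha1 norm i)
    (@alpha_inj _ _ _ _ _ norm i) (@alphaJ _ _ _ _ _ norm i) GF.
move=> x y xR yR; apply/matrixP => i j; rewrite [RHS]mxE.
have [<-|nij] := eqVneq i j.
  by rewrite !(psi_diag norm) ?rpredD // mxE add_alpha.
have [Pij|nPij] := boolP (P i j).
  by have [_ _ add _] := addP i j Pij nij; apply: add.
(* Here [x i j = 0], but [psi x i j] may be nonzero, since [E j i] may be mapped to a multiple of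
   [E i j]. *)
have [Pji|nPji] := boolP (P j i).
  by have [|_ _ _ add] := addP j i Pji; [rewrite eq_sym|apply: add].
have zero z : z \in smr_mem P -> psi z i j = 0.
  by move=> /[dup] zR /smr_memP z0; rewrite (psi_off_eq0 D_division norm) ?z0.
by rewrite !zero ?rpredD // addr0.
Qed.
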